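(* Let $q,s,r,t$ be integers with $2\le q<s\le 2q$ and $r\ge t\ge 1$. There exists $n(q,s,r,t)$ such that if $n\ge n(q,s,r,t)$ and $\mathcal{F}\subseteq\{0,1,\dots,q\}^n$ is $r$-support uniform and $s$-sum $t$-intersecting, then \[ |\mathcal{F}|\le \begin{cases} \left(q-\frac{s}{2}+1\right)^t q^{r-t}\binom{n-t}{r-t} & \text{if } s \text{ is even},\\[4pt] f(n,q,s,r,t) & \text{if } s \text{ is odd}, \end{cases} \] and these bounds are best possible: for $s$ even equality is attained by $\mathcal{F}_{n,q,s,r,T}$ for any $T\in\binom{[n]}{t}$, and for $s$ odd by $\mathcal{F}_{n,q,s,r,t}$.
   Context: For $\mathbf{x}\in\{0,\dots,q\}^n$, $S_{\mathbf{x}}=\{i:x_i\ne0\}$; a family is $r$-support uniform if $|S_{\mathbf{x}}|=r$ for all members. Vectors $\mathbf{x},\mathbf{y}$ are $s$-sum $t$-intersecting if $|\{i:x_i+y_i\ge s\}|\ge t$; a family is $s$-sum $t$-intersecting if any two distinct members are. For $s$ even and $T\in\binom{[n]}{t}$: $\mathcal{F}_{n,q,s,r,T}=\{\mathbf{x}\in\{0,\dots,q\}^n: x_i\ge s/2 \text{ for all } i\in T,\ |S_{\mathbf{x}}|=r\}$. For $s$ odd (so $q<s<2q$) and $n\ge r\ge t$: for each $T'\in\binom{[r]}{t-1}$ pick a vector $\mathbf{x}_{T'}$ with $S_{\mathbf{x}_{T'}}=[r]$, $(x_{T'})_i>s/2$ for $i\in T'$ and $(x_{T'})_i=\lfloor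 s/2\rfloor$ for $i\in[r]\setminus T'$; let \[ \mathcal{F}_{n,q,s,r,t}=\Big\{\mathbf{x}_{T'}:T'\in\tbinom{[r]}{t-1}\Big\}\cup\bigcup_{T\in\binom{[r]}{t}}\Big\{\mathbf{y}\in\{0,\dots,q\}^n: y_i>\lfloor \tfrac s2\rfloor\ \forall i\in T,\ y_i=\lfloor\tfrac s2\rfloor\ \forall i\in[\max T]\setminus T,\ |S_{\mathbf{y}}|=r\Big\}, \] and let $f(n,q,s,r,t)=|\mathcal{F}_{n,q,s,r,t}|$ (which does not depend on the choice of the $\mathbf{x}_{T'}$). *)

(* Defs.v *)
From mathcomp Require Import all_boot.

Set Implicit Arguments.
Unset Strict Implicit.
Unset Printing Implicit Defensive.

Definition qvec (q n : nat) := {ffun 'I_n -> 'I_q.+1}.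

Section Families.
Variables q n : nat.
Implicit Types (x y : qvec q n) (F : {set qvec q n}) (T : {set 'I_n}).

Definition supp x : {set 'I_n} := [set i | val (x i) != 0].

Definition support_uniform (r : nat) F : Prop :=
  forall x, x \in F -> #|supp x| = r.

Definition sum_intersect (s t : nat) x y : bool :=
  t <= #|[set i | s <= x i + y i]|.

Definition sum_intersecting (s t : nat) F : Prop :=
  forall x y, x \in F -> y \in F -> x <> y -> sum_intersect s t x y.

(* Only used for even s. *)
Definition even_family (s r : nat) T : {set qvec q n} :=
  [set x : qvec q n | [forall i in T, s./2 <= x i] & #|supp x| == r].

(* Coordinates are 0-based: [m] = {1, ..., m} becomes {0, ..., m - 1}. *)
Definition seg (m : nat) : {set 'I_n} := [set i : 'I_n | i < m].

(* The 1-based maximum of T, so that seg (max1 T) is [max T]. *)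
Definition max1 T : nat := \max_(j in T) j.+1.

Definition subsets (r k : nat) : {set {set 'I_n}} :=
  [set T : {set 'I_n} | T \subset seg r & #|T| == k].

(* c T' is the chosen vector x_T'; s < 2 * x_i expresses x_i > s/2 without
   rounding. *)
Definition admissible (s r t : nat) (c : {set 'I_n} -> qvec q n) : Prop :=
  forall T, T \in subsets r (t - 1) ->
    [/\ supp (c T) = seg r,
        forall i, i \in T -> s < 2 * c T i
      & forall i, i \in seg r :\: T -> c T i = s./2 :> nat].

Definition odd_block (s r : nat) T : {set qvec q n} :=
  [set y : qvec q n | [&& [forall i in T, s./2 < y i],
                          [forall i in seg (max1 T) :\: T, val (y i) == s./2]
                        & #|supp y| == r]].

(* Only used for odd s. *)
Definition odd_family (s r t : nat) (c : {set 'I_n} -> qvec q n) :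
    {set qvec q n} :=
  (c @: subsets r (t - 1)) :|: \bigcup_(T in subsets r t) odd_block s r T.

Definition std_choice (s r : nat) T : qvec q n :=
  [ffun i => inord (if i \in T then s./2.+1 else
                    if i \in seg r then s./2 else 0)].

End Families.

(* f(n, q, s, r, t): std_choice is admissible (std_choice_admissible) and the
   cardinality is the same for every admissible choice
   (card_odd_family_indep). *)
Definition f (n q s r t : nat) : nat :=
  #|odd_family s r t (@std_choice q n s r)|.

Lemma std_choice_admissible (q n s r t : nat) :
  1 < q -> q < s -> s <= 2 * q -> odd s ->
  admissible s r t (@std_choice q n s r).
Proof.
move=> q2 qs s2q os T; rewrite inE => /andP[/subsetP sT _].
have hs : s = s./2.*2.+1 by rewrite -[LHS]odd_double_half os.
have h1 : s./2.+1 <= q.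
  by move: s2q; rewrite {1}hs mul2n ltn_double.
have h0 : 0 < s./2 by rewrite half_gt0 (leq_trans q2 (ltnW qs)).
split=> [|i iT|i].
- apply/setP => i; rewrite !inE ffunE inE.
  case: ifP => [/sT|_]; first by rewrite inE => ->; rewrite /= inordK.
  by case: ifP => _; rewrite /= inordK // ?(ltnW h1) // ?lt0n_neq0 // ltnW.
- by rewrite ffunE iT inordK // {1}hs mul2n doubleS ltnSn.
- by rewrite inE ffunE => /andP[/negbTE-> ->]; rewrite inordK // ltnW.
Qed.

Lemma card_odd_family_indep (q n s r t : nat)
    (c d : {set 'I_n} -> qvec q n) :
  0 < t -> odd s -> admissible s r t c -> admissible s r t d ->
  #|odd_family s r t c| = #|odd_family s r t d|.
Proof.
move=> t0 os.
have hs : s = s./2.*2.+1 by rewrite -[LHS]odd_double_half os.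
suff H (e : {set 'I_n} -> qvec q n) : admissible s r t e -> #|odd_family s r t e| =
    #|subsets n r (t - 1)| + #|\bigcup_(T in subsets n r t) @odd_block q n s r T|.
  by move=> /H-> /H->.
move=> ae.
have rec T : T \in subsets n r (t - 1) ->
    [set i in seg n r | s./2 < e T i] = T.
  move=> hT; have [_ h1 h2] := ae T hT.
  move: hT; rewrite inE => /andP[/subsetP sT _].
  apply/setP => i; rewrite inE; case iT: (i \in T).
    by rewrite sT //=; move: (h1 i iT); rewrite {1}hs mul2n => /ltnW; rewrite ltn_double.
  by case ir: (i \in seg n r) => //=; rewrite h2 ?ltnn // inE iT.
rewrite cardsU card_in_imset => [|T T' hT hT' eT]; last first.
  by rewrite -(rec T hT) -(rec T' hT') eT.
rewrite (_ : _ :&: _ = set0) ?cards0 ?subn0 //.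
apply/setP => y; rewrite !inE; apply/negbTE/negP => /andP[/imsetP[T hT ->]].
case/bigcupP => U; rewrite inE => /andP[/subsetP sU /eqP cU].
rewrite inE => /and3P[/forall_inP hU _ _].
have : #|U| <= #|T|.
  rewrite -(rec T hT); apply/subset_leq_card/subsetP => i iU.
  by rewrite inE sU // hU.
move: hT; rewrite inE cU => /andP[_ /eqP->].
by rewrite leqNgt subn1 prednK ?leqnn.
Qed.

(* Main.v *)
(** For large [n], either all supports contain a common [t]-set [T], or they all
    meet a kernel of bounded size in at least [t + 1] points; the latter leaves
    only [O(n^(r-t-1))] vectors, which is negligible.  Given [T], if some
    member is below [s./2] at a point of [T], then one of the main patterns on [T]
    carries only negligibly many members, and again the bound holds.  Otherwise
    all members are at least [s./2] on [T], which settles [s] even.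

    For [s] odd, split the family by the set [L] of points of [T] where a vector
    takes the value [s./2].  Two vectors with the same [L] meet on [T] exactly in
    [T \ L], so outside [T] they are [#|L|]-intersecting with supports of size
    [r - t], and induction on [r] applies; sets [L] larger than [r - t] contribute
    at most ['C(t, r - t + 1)] vectors.  Both the main terms and the error terms
    then add up by Vandermonde's identity.  The induction needs vectors that differ
    outside the region in which they are required to intersect; the bounds are
    linear in the number of restrictions to the complement of that region, while
    the threshold on its size does not depend on that number. *)

Require Import Defs.
From mathcomp Require Import all_boot zify.

Set Implicit Arguments.
Unset Strict Implicit.
Unset Printing Implicit Defensive.

(** * Unions of finite sets and binomial sums *)

Lemma leq_card_bigcup (I T : finType) (P : {set I}) (B : I -> {set T}) :
  #|\bigcup_(i in P) B i| <= \sum_(i in P) #|B i|.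
Proof.
elim/big_rec2: _ => [|i m S _ le_m]; first by rewrite cards0.
by rewrite (leq_trans (leq_card_setU _ _)) // leq_add2l.
Qed.

Lemma leq_sum_card_bigcup (I T : finType) (P : {set I}) (B : I -> {set T}) :
  (forall i j y, i \in P -> j \in P -> y \in B i -> y \in B j -> i = j) ->
  \sum_(i in P) #|B i| <= #|\bigcup_(i in P) B i|.
Proof.
move=> inj; under eq_bigr do rewrite -sum1_card.
rewrite -[leqRHS]sum1_card.
rewrite (exchange_big_dep (mem (\bigcup_(i in P) B i))) /=; last first.
  by move=> i y iP yB; apply/bigcupP; exists i.
apply: leq_sum => y _; rewrite sum1_card; apply/card_le1_eqP => i j.
by move=> /andP[iP yi] /andP[jP yj]; exact: inj yj yi.
Qed.

Lemma ex_subset_card (T : finType) (B : {set T}) k : k <= #|B| ->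
  exists2 A : {set T}, A \subset B & #|A| = k.
Proof.
move=> kB; have : 0 < #|[set A : {set T} | A \subset B & #|A| == k]|.
  by rewrite cards_draws bin_gt0.
by case/card_gt0P => A; rewrite inE => /andP[AB /eqP cA]; exists A.
Qed.

(** This is Vandermonde's identity for ['C(t + m, m.+1)]: the term taking nothing from the [t]-part
    vanishes, and ['C(m, m - z) = 'C(m, z)]. Terms with [z > m] are zero, so a larger [k] adds
    nothing and a smaller one drops terms. *)
Lemma sum_bin_shift t m k : 0 < t ->
  \sum_(z < k) 'C(t, z.+1) * 'C(m, z) <= 'C(t + m, t.-1).
Proof.
move=> t0.
have -> : 'C(t + m, t.-1) = \sum_(z < m.+1) 'C(t, z.+1) * 'C(m, z).
  have mt : m.+1 <= t + m by rewrite -add1n leq_add2r.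
  rewrite (_ : t.-1 = t + m - m.+1); last by lia.
  rewrite bin_sub // -Vandermonde big_ord_recl /= subn0 bin0 mul1n bin_small // add0n.
  by apply: eq_bigr => z _; rewrite /bump /= add1n subSS bin_sub // -ltnS.
have small j : m < j -> 'C(t, j.+1) * 'C(m, j) = 0.
  by move=> mj; rewrite [X in _ * X]bin_small ?muln0.
have toN i : \sum_(z < i) 'C(t, z.+1) * 'C(m, z) =
    \sum_(0 <= z < i) 'C(t, z.+1) * 'C(m, z).
  by rewrite big_mkord.
rewrite !toN.
have [km|mk] := leqP k m.+1; first by rewrite [leqRHS](big_cat_nat (n := k)) //= leq_addr.
rewrite (big_cat_nat (n := m.+1)) ?(ltnW mk) //=.
rewrite [X in _ + X](_ : _ = 0) ?addn0 // big_nat_cond big1 //.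
by move=> j /andP[/andP[mj _] _]; rewrite small.
Qed.

Lemma sum_subsets_card (T : finType) (B : {set T}) k (G : nat -> nat) :
  \sum_(L in powerset B | 0 < #|L| <= k) G #|L| = \sum_(z < k) 'C(#|B|, z.+1) * G z.+1.
Proof.
have -> : \sum_(z < k) 'C(#|B|, z.+1) * G z.+1 =
    \sum_(z < k.+1 | 0 < z) 'C(#|B|, z) * G z.
  by rewrite [RHS]big_mkcond [RHS]big_ord_recl /= add0n; apply: eq_bigr.
rewrite (partition_big (fun L : {set T} => inord #|L| : 'I_k.+1) (fun z => 0 < z)) /=.
  apply: eq_bigr => z z0; rewrite -cards_draws -sum_nat_const.
  apply: eq_big => [L|L]; last first.
    by case/andP=> /andP[_ /andP[_ Lk]] /eqP <-; rewrite inordK.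
  rewrite !inE; case: (L \subset B) => //=; apply/andP/eqP => [[/andP[_ Lk] /eqP <-]|->].
    by rewrite inordK.
  rewrite z0 -ltnS ltn_ord; split=> //; apply/eqP/val_inj; rewrite /= inordK //.
by move=> L /andP[_ /andP[L0 Lk]]; rewrite inordK.
Qed.

(** * Restrictions of vectors and counts with prescribed entries *)

Section Vectors.
Variables q n : nat.
Implicit Types (x y : qvec q n) (F : {set qvec q n}) (S T U V W Z : {set 'I_n}).
Implicit Types A : 'I_n -> {set 'I_q.+1}.

(** Entries outside [V] become 0 instead of being dropped, so that restrictions to different sets
    share one type and supports are simply cut down to [V]. *)
Definition restr V x : qvec q n := [ffun i => if i \in V then x i else ord0].

Lemma supp_restr V x : supp (restr V x) = supp x :&: V.
Proof.
by apply/setP => i; rewrite !inE ffunE; case: (i \in V); rewrite ?andbT ?andbF.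
Qed.

Lemma restr_in V x i : i \in V -> restr V x i = x i.
Proof. by move=> iV; rewrite ffunE iV. Qed.

Lemma restrT x : restr setT x = x.
Proof. by apply/ffunP => i; rewrite ffunE inE. Qed.

Lemma restrI V W x : restr V (restr W x) = restr (V :&: W) x.
Proof. by apply/ffunP => i; rewrite !ffunE inE; case: (i \in V). Qed.

Lemma leq_card_restrU V W F :
  #|restr (V :|: W) @: F| <= #|restr V @: F| * #|restr W @: F|.
Proof.
rewrite -cardsX.
have inj : {in restr (V :|: W) @: F &, injective (fun z => (restr V z, restr W z))}.
  move=> _ _ /imsetP[x _ ->] /imsetP[y _ ->] [/ffunP eV /ffunP eW].
  apply/ffunP => i; move: (eV i) (eW i); rewrite !ffunE !inE.
  by case: (i \in V); case: (i \in W).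
rewrite -(card_in_imset inj); apply: subset_leq_card; apply/subsetP => p.
case/imsetP => _ /imsetP[x xF ->] ->; rewrite inE /= !restrI setKU.
by rewrite [V :|: W]setUC setKU !imset_f.
Qed.

Definition pinned V r T A : {set qvec q n} :=
  [set x : qvec q n | [&& supp x \subset V, #|supp x| == r
                        & [forall i in T, x i \in A i]]].

Lemma card_supersets V T r : T \subset V -> #|T| <= r ->
  #|[set S : {set 'I_n} | [&& T \subset S, S \subset V & #|S| == r]]|
  = 'C(#|V| - #|T|, r - #|T|).
Proof.
move=> TV Tr.
rewrite -(_ : #|V :\: T| = #|V| - #|T|); last by rewrite cardsD (setIidPr TV).
rewrite -(cards_draws (V :\: T)).
have inj : {in [set S : {set 'I_n} | [&& T \subset S, S \subset V & #|S| == r]] &,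
   injective (fun S => S :\: T)}.
  move=> S1 S2; rewrite !inE => /and3P[T1 _ _] /and3P[T2 _ _] e.
  by rewrite -(setID S1 T) -(setID S2 T) e (setIidPr T1) (setIidPr T2).
rewrite -(card_in_imset inj); congr #|pred_of_set _|; apply/setP => S.
rewrite inE; apply/imsetP/andP => [[S1]|[SV /eqP cS]].
  rewrite inE => /and3P[T1 V1 /eqP c1] ->; split; first exact: setSD.
  by rewrite cardsD (setIidPr T1) c1.
have dST : [disjoint S & T].
  by move: SV; rewrite subsetD => /andP[].
exists (S :|: T); last first.
  by rewrite setDUl setDv setU0; move: dST; rewrite -setI_eq0 => /eqP dST;
     rewrite -[LHS](setID S T) dST set0U.
rewrite inE subsetUr subUset TV andbT /=; apply/andP; split.
  by apply: subset_trans SV _; exact: subsetDl.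
by have [_] := leq_card_setU S T; rewrite dST => /eqP->; rewrite cS subnK.
Qed.

(** Since 0 is excluded on [T], every support contains [T]. Fix the support first; then the entries
    are independent, with [#|A i|] choices on [T] and [q] nonzero values elsewhere on the
    support. *)
Lemma card_pinned V r T A :
  T \subset V -> #|T| <= r -> (forall i, i \in T -> ord0 \notin A i) ->
  #|pinned V r T A|
  = (\prod_(i in T) #|A i|) * (q ^ (r - #|T|) * 'C(#|V| - #|T|, r - #|T|)).
Proof.
move=> TV Tr A0.
pose P := [set S : {set 'I_n} | [&& T \subset S, S \subset V & #|S| == r]].
have supE x : x \in pinned V r T A -> supp x \in P.
  rewrite !inE => /and3P[-> -> /forall_inP h]; rewrite !andbT.
  apply/subsetP => i iT; rewrite inE; apply: contra (A0 i iT) => /eqP x0.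
  by move: (h i iT); rewrite (_ : x i = ord0) //; apply: val_inj.
rewrite -sum1_card (partition_big (@supp q n) (mem P)) //=.
under eq_bigr => S SP.
  rewrite (_ : \sum_(_ | _) 1 = \prod_(i in T) #|A i| * q ^ (r - #|T|)); last first.
    move: SP; rewrite inE => /and3P[TS SV /eqP cS].
    pose B i : {set 'I_q.+1} := if i \in T then A i else
             if i \in S then [set~ ord0] else [set ord0].
    rewrite sum1dep_card.
    transitivity #|family B|.
      apply: eq_card => x; rewrite inE; apply/andP/familyP => [[hx /eqP sx] i|hx].
        rewrite /B; move: hx; rewrite inE => /and3P[_ _ /forall_inP h].
        case: ifP => [/h //|_]; rewrite -sx inE.
        by case: ifP => [|/negbFE]; rewrite ?inE.
      have sx : supp x = S.
        apply/setP => i; rewrite inE; move: (hx i); rewrite /B.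
        case: ifP => iT.
          rewrite (subsetP TS) // => xi; apply: contraTN xi => /eqP x0.
          by rewrite (_ : x i = ord0) ?A0 //; apply: val_inj.
        by case: ifP; rewrite !inE => _; [|move/eqP->].
      rewrite sx eqxx inE sx SV cS eqxx; split=> //=; apply/forall_inP => i iT.
      by move: (hx i); rewrite /B iT.
    rewrite card_family foldrE big_map big_enum /= (bigID (mem T)) /=; congr (_ * _).
      by apply: eq_bigr => i iT; rewrite /B iT.
    rewrite (bigID (mem S)) /= [X in _ * X]big1 ?muln1.
      rewrite (eq_bigr (fun=> q)); last first.
        move=> i /andP[/negbTE iT iS]; rewrite /B iT iS.
        by rewrite cardsC1 card_ord.
      rewrite prod_nat_const; congr (_ ^ _).
      rewrite -cS (_ : #|S| - #|T| = #|S :\: T|); last first.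
        by rewrite cardsD (setIidPr TS).
      by apply: eq_card => i; rewrite !inE.
    by move=> i /andP[/negbTE iT /negbTE iS]; rewrite /B iT iS cards1.
  over.
by rewrite sum_nat_const /P card_supersets // mulnC mulnA.
Qed.


Lemma pinned_supp T A x : (forall i, i \in T -> ord0 \notin A i) ->
  (forall i, i \in T -> x i \in A i) -> T \subset supp x.
Proof.
move=> A0 hx; apply/subsetP => i iT; rewrite inE.
apply: contra (A0 i iT) => /eqP x0.
by move: (hx i iT); rewrite (_ : x i = ord0) //; apply: val_inj.
Qed.

Lemma restr_pinned T A x : (forall i, i \in T -> ord0 \notin A i) ->
  (forall i, i \in T -> x i \in A i) -> restr T x \in pinned T #|T| T A.
Proof.
move=> A0 hx; rewrite inE supp_restr subsetIr (setIidPr (pinned_supp A0 hx)) eqxx.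
by apply/forall_inP => i iT; rewrite restr_in // hx.
Qed.

Lemma card_pinned_self T A : (forall i, i \in T -> ord0 \notin A i) ->
  #|pinned T #|T| T A| = \prod_(i in T) #|A i|.
Proof.
by move=> A0; rewrite card_pinned // !subnn bin0 !muln1.
Qed.

Lemma leq_card_region V k F : (forall x, x \in F -> #|supp x :&: V| = k) ->
  #|F| <= #|restr (~: V) @: F| * (q ^ k * 'C(#|V|, k)).
Proof.
move=> hF; have {1}-> : F = restr (~: V :|: V) @: F.
  by rewrite setUC setUCr (eq_imset _ restrT) imset_id.
apply: leq_trans (leq_card_restrU _ _ _) _; rewrite leq_mul2l.
apply/orP; right.
(* With no pinned coordinates, [pinned] consists of all vectors having [k] support points, all in
   [V]. *)
have := @card_pinned V k set0 (fun=> set0) (sub0set _).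
rewrite cards0 big_set0 mul1n !subn0 => <- //; last by move=> i; rewrite inE.
apply: subset_leq_card; apply/subsetP => _ /imsetP[x xF ->].
rewrite inE supp_restr subsetIr hF // eqxx /=.
by apply/forall_inP => i; rewrite inE.
Qed.

Lemma leq_card_restr_pinned T A F :
  (forall x i, x \in F -> i \in T -> x i \in A i) ->
  (forall i, i \in T -> ord0 \notin A i) ->
  #|restr T @: F| <= \prod_(i in T) #|A i|.
Proof.
move=> hF A0; rewrite -(card_pinned_self A0); apply: subset_leq_card.
by apply/subsetP => _ /imsetP[x xF ->]; apply: restr_pinned => // i; apply: hF.
Qed.

(** The number of patterns on [T] stays a separate factor because [deviating_bound] gains precisely
    from one missing pattern. *)
Lemma leq_card_split U T r F : T \subset U ->
  (forall x, x \in F -> #|supp x :&: U| = r) ->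
  (forall x, x \in F -> T \subset supp x) ->
  #|F| <= #|restr (~: U) @: F| *
          (#|restr T @: F| * (q ^ (r - #|T|) * 'C(#|U| - #|T|, r - #|T|))).
Proof.
move=> TU hr hT; rewrite mulnA.
have <- : #|U :\: T| = #|U| - #|T| by rewrite cardsD (setIidPr TU).
apply: leq_trans (leq_card_region (V := U :\: T) (k := r - #|T|) _) _.
  by move=> x xF; rewrite setIDA cardsD hr // -setIA (setIidPr TU) (setIidPr _) ?hT.
by rewrite leq_mul2r setCD leq_card_restrU ?orbT.
Qed.

Lemma leq_card_pinned U T r A F : T \subset U ->
  (forall x, x \in F -> #|supp x :&: U| = r) ->
  (forall x i, x \in F -> i \in T -> x i \in A i) ->
  (forall i, i \in T -> ord0 \notin A i) ->
  #|F| <= #|restr (~: U) @: F| *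
          (\prod_(i in T) #|A i| * (q ^ (r - #|T|) * 'C(#|U| - #|T|, r - #|T|))).
Proof.
move=> TU hr hA A0; apply: leq_trans (leq_card_split TU hr _) _.
  by move=> x xF; apply: pinned_supp A0 _ => i; apply: hA.
by rewrite leq_mul2l leq_mul2r leq_card_restr_pinned ?orbT.
Qed.

Lemma leq_card_supersets U Z r F : Z \subset U ->
  (forall x, x \in F -> #|supp x :&: U| = r) ->
  (forall x, x \in F -> Z \subset supp x) ->
  #|F| <= #|restr (~: U) @: F| * (q ^ r * 'C(#|U| - #|Z|, r - #|Z|)).
Proof.
move=> ZU hr hZ; have [->|[x0 x0F]] := set_0Vmem F; first by rewrite cards0.
have Zr : #|Z| <= r.
  by rewrite -(hr _ x0F) subset_leq_card // subsetI hZ.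
have := @leq_card_pinned U Z r (fun=> [set~ ord0]) F ZU hr.
rewrite prod_nat_const cardsC1 card_ord /=.
rewrite [q ^ #|Z| * _]mulnA -expnD subnKC //; apply.
  move=> x i xF iZ; move: (subsetP (hZ x xF) i iZ); rewrite !inE.
  by apply: contra => /eqP->.
by move=> i _; rewrite !inE eqxx.
Qed.

Lemma leq_card_cover U r k (Q : {set {set 'I_n}}) F :
  (forall x, x \in F -> #|supp x :&: U| = r) ->
  (forall Z, Z \in Q -> Z \subset U /\ #|Z| = k) ->
  (forall x, x \in F -> exists2 Z, Z \in Q & Z \subset supp x) ->
  #|F| <= #|Q| * (#|restr (~: U) @: F| * (q ^ r * 'C(#|U| - k, r - k))).
Proof.
move=> hr hQ hF.
have sF : F \subset \bigcup_(Z in Q) [set x in F | Z \subset supp x].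
  apply/subsetP => x xF; have [Z ZQ Zx] := hF x xF.
  by apply/bigcupP; exists Z => //; rewrite inE xF.
apply: leq_trans (subset_leq_card sF) _.
apply: leq_trans (leq_card_bigcup _ _) _; rewrite -sum_nat_const.
apply: leq_sum => Z /hQ[ZU <-].
set G := [set x in F | _]; have GF : G \subset F.
  by apply/subsetP => x; rewrite inE => /andP[].
apply: leq_trans (leq_card_supersets (r := r) ZU _ _) _.
- by move=> x /(subsetP GF)/hr.
- by move=> x; rewrite inE => /andP[].
- by rewrite leq_mul2r subset_leq_card ?orbT // imsetS.
Qed.

Lemma card_ord_geq c : #|[set a : 'I_q.+1 | c <= a]| = q.+1 - c.
Proof.
have -> : #|[set a : 'I_q.+1 | c <= a]| = \sum_(0 <= a < q.+1 | c <= a) 1.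
  by rewrite -sum1dep_card big_mkord.
by rewrite -(big_nat_widenl c 0 q.+1 xpredT) // sum_nat_const_nat muln1.
Qed.

(** * Intersecting families on a region and their kernels *)

(* Supports and intersections are only counted inside [U]; the restrictions of the
   members to [~: U] are arbitrary. *)
Definition region_family s U r t F : Prop :=
  (forall x, x \in F -> #|supp x :&: U| = r) /\
  (forall x y, x \in F -> y \in F -> x <> y ->
     t <= #|[set i in U | s <= x i + y i]|).

Lemma sum_supp s x y i : q < s -> s <= x i + y i -> i \in supp x :&: supp y.
Proof.
move=> qs le_s; rewrite !inE.
by have := ltn_ord (x i); have := ltn_ord (y i); move: le_s => /=; lia.
Qed.

Lemma region_meet s U r t F x y : q < s -> t <= r -> region_family s U r t F ->
  x \in F -> y \in F -> t <= #|supp x :&: supp y :&: U|.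
Proof.
move=> qs tr [hr hF] xF yF; case: (x =P y) => [<-|/(hF _ _ xF yF) le_t].
  by rewrite setIid hr.
apply: leq_trans le_t (subset_leq_card _); apply/subsetP => i.
by rewrite !inE => /andP[-> /(sum_supp qs)]; rewrite !inE => ->.
Qed.

(** For [x <> y], if the at least [t] intersecting coordinates all lay in [T], they would fill [T]
    and include [j]. For [x = y], the extra point comes from [t < r]. *)
Lemma region_meet_outside s U r t F T x y j :
    q < s -> t < r -> region_family s U r t F -> T \subset U -> #|T| = t ->
    x \in F -> y \in F -> j \in T -> x j + y j < s ->
  exists w, w \in (supp x :&: supp y :&: U) :\: T.
Proof.
move=> qs tr [hr hF] TU cT xF yF jT lt_s; apply/set0Pn; rewrite -card_gt0.
case: (x =P y) => [e|/(hF _ _ xF yF) le_t].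
  rewrite -e setIid cardsD hr // subn_gt0; apply: leq_ltn_trans tr.
  by rewrite -cT subset_leq_card ?subsetIr.
rewrite card_gt0; apply/set0Pn.
have [sub|/subsetPn[w]] := boolP ([set i in U | s <= x i + y i] \subset T).
  have /eqP e : [set i in U | s <= x i + y i] == T by rewrite eqEcard sub cT.
  by move: jT; rewrite -e inE leqNgt lt_s andbF.
rewrite inE => /andP[wU /(sum_supp qs) ws] wT.
by exists w; rewrite inE wT inE ws.
Qed.

(* A fixed support together with, for each of its [t]-subsets, a support avoiding
   it: a set meeting all of these in [t] points meets their union in [t + 1]. *)
Lemma ex_kernel s U r t F : q < s -> t <= r -> region_family s U r t F ->
  (forall T, T \subset U -> #|T| = t -> exists2 x, x \in F & ~~ (T \subset supp x)) ->
  exists Q : {set {set 'I_n}},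
    [/\ #|Q| <= 2 ^ (r + 2 ^ r * r),
        forall Z, Z \in Q -> Z \subset U /\ #|Z| = t.+1
      & forall x, x \in F -> exists2 Z, Z \in Q & Z \subset supp x].
Proof.
move=> qs tr rF noT; have [hr hF] := rF.
have [->|[x1 x1F]] := set_0Vmem F.
  by exists set0; split=> [|Z|x]; rewrite ?cards0 ?inE.
(* The default [x1] keeps [g T] in [F] for every [T]. The union in [Y] then runs over all subsets of
   [S1], which is where the factor [2 ^ r] comes from. *)
pose g T := odflt x1 [pick x in F | ~~ (T \subset supp x)].
have gF T : g T \in F.
  by rewrite /g; case: pickP => [x /andP[] //|_].
pose S1 := supp x1 :&: U.
pose Y := S1 :|: \bigcup_(T in powerset S1) (supp (g T) :&: U).
have YU : Y \subset U.
  rewrite subUset subsetIr; apply/bigcupsP => T _; exact: subsetIr.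
have cY : #|Y| <= r + 2 ^ r * r.
  apply: leq_trans (leq_card_setU _ _) _; rewrite hr // leq_add2l.
  apply: leq_trans (leq_card_bigcup _ _) _.
  rewrite (eq_bigr (fun=> r)) => [|T _]; last by rewrite hr.
  by rewrite sum_nat_const card_powerset hr.
exists [set Z : {set 'I_n} | Z \subset Y & #|Z| == t.+1]; split.
- apply: leq_trans (_ : #|powerset Y| <= _); last first.
    by rewrite card_powerset leq_exp2l.
  apply: subset_leq_card; apply/subsetP => Z.
  by rewrite !inE => /andP[].
- move=> Z; rewrite inE => /andP[ZY /eqP cZ]; split=> //.
  exact: subset_trans ZY YU.
move=> x xF.
have [T] := ex_subset_card (region_meet qs tr rF xF x1F).
rewrite -setIA subsetI => /andP[Tx TS1] cT.
have TU : T \subset U := subset_trans TS1 (subsetIr _ _).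
have nTg : ~~ (T \subset supp (g T)).
  rewrite /g; case: pickP => [y /andP[] //|].
  by have [y yF nTy] := noT T TU cT => /(_ y); rewrite yF nTy.
(* The supports of [x] and [g T] share at least [t] points of [U]. If these all lay in [T] they
   would be [T], contradicting the choice of [g T]; so there is a further common point [w], and it
   lies in [Y]. *)
have [sub|/subsetPn[w]] := boolP (supp x :&: supp (g T) :&: U \subset T).
  have /eqP e : supp x :&: supp (g T) :&: U == T.
    by rewrite eqEcard sub cT (region_meet qs tr rF).
  have := subsetIr (supp x) (supp (g T)) => /(subset_trans (subsetIl _ U)).
  by rewrite e (negbTE nTg).
rewrite 2!in_setI -andbA => /and3P[wx wg wU] wT.
exists (w |: T); last by rewrite subUset sub1set wx.
rewrite inE cardsU1 wT cT eqxx andbT subUset sub1set in_setU.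
rewrite (subset_trans TS1 (subsetUl _ _)) andbT; apply/orP; right.
by apply/bigcupP; exists T; [rewrite inE | rewrite in_setI wg wU].
Qed.


(** * Thresholds and stability *)

(** The first factor is the size bound of [ex_kernel]. The power of [q] pays for the [q ^ r] values
    on a support and, in [deviating_bound], for the up to [q ^ r] patterns on [T]. *)
Definition ratio r := 2 ^ (r + 2 ^ r * r) * q ^ (2 * r).

Definition threshold r := r + r * ratio r.

(** The quotient of the two binomials is [(m - t) / (r - t)], and the threshold gives
    [m - t >= r * ratio r]. *)
Lemma ratio_bin r t m : t < r -> threshold r <= m ->
  ratio r * 'C(m - t.+1, r - t.+1) <= 'C(m - t, r - t).
Proof.
move=> tr rm; have rt0 : 0 < r - t by rewrite subn_gt0.
rewrite -(leq_pmul2l rt0).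
have -> : r - t = (r - t.+1).+1 by rewrite -subSn.
rewrite -mul_bin_diag !subnS mulnA leq_mul2r; apply/orP; right.
move: rm; rewrite /threshold; set k := ratio r => rm.
apply: leq_trans (_ : r * k <= _); first by rewrite leq_mul2r; lia.
lia.
Qed.

(* [F1] misses the constant pattern [uphalf s] on [T].  The vectors outside [F1]
   meet [W] off [T]: those with the constant pattern because of [x], those with
   an entry below [uphalf s] because of the representative of their own pattern. *)
Lemma deviating_bound s U r t F T x i :
    1 < q -> q < s -> s <= 2 * q -> t < r -> threshold r <= #|U| ->
    region_family s U r t F -> T \subset U -> #|T| = t ->
    (forall y, y \in F -> T \subset supp y) ->
    x \in F -> i \in T -> x i < s./2 ->
  #|F| <= #|restr (~: U) @: F| *
          ((q.+1 - uphalf s) ^ t * (q ^ (r - t) * 'C(#|U| - t, r - t))).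
Proof.
move=> q2 qs s2q tr Ur rF TU cT hT xF iT xi; have [hr _] := rF.
set c := uphalf s; have cE : c + s./2 = s by rewrite /c uphalf_half; lia.
have c_half : s./2 <= c by rewrite /c uphalf_half leq_addl.
have c0 : 0 < c by lia.
have cq : c <= q by rewrite /c; lia.
set p := #|restr (~: U) @: F|; set B := q ^ _ * _.
pose A (_ : 'I_n) := [set a : 'I_q.+1 | c <= a].
have A0 j : j \in T -> ord0 \notin A j by rewrite inE -ltnNge.
pose cst : qvec q n := [ffun=> inord c].
have cstE j : cst j = c :> nat by rewrite ffunE inordK.
pose F1 := [set y in F | [forall j in T, c <= y j] && (restr T y != restr T cst)].
have F1F : F1 \subset F by apply/subsetP => y; rewrite inE => /andP[].
have b1 : #|F1| <= p * (((q.+1 - c) ^ t).-1 * B).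
  rewrite /B -cT; apply: leq_trans (leq_card_split (r := r) TU _ _) _.
  - by move=> y /(subsetP F1F)/hr.
  - by move=> y /(subsetP F1F)/hT.
  apply: leq_mul; first by rewrite subset_leq_card // imsetS.
  rewrite leq_mul2r; apply/orP; right.
  have <- : #|pinned T #|T| T A :\ restr T cst| = ((q.+1 - c) ^ #|T|).-1.
    rewrite -subn1 -[1](cards1 (restr T cst)) cardsD (setIidPr _).
      rewrite card_pinned_self // (eq_bigr (fun=> q.+1 - c)).
        by rewrite prod_nat_const.
      by move=> j _; rewrite card_ord_geq.
    rewrite sub1set restr_pinned // => j _.
    by rewrite inE cstE.
  apply: subset_leq_card; apply/subsetP => _ /imsetP[y + ->].
  rewrite inE => /and3P[yF /forall_inP hy ny].
  rewrite in_setD1 ny restr_pinned // => j jT; by rewrite inE hy.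
(* [g a] is a representative in [F] of the pattern [a] on [T]. *)
pose g a := odflt x [pick y in F | restr T y == a].
have gF a : g a \in F by rewrite /g; case: pickP => [y /andP[] //|_].
have gE y : y \in F -> restr T (g (restr T y)) = restr T y.
  by move=> yF; rewrite /g; case: pickP => [z /andP[_ /eqP] //|/(_ y)]; rewrite yF eqxx.
pose W := ((supp x :&: U) :|: \bigcup_(a in restr T @: F) (supp (g a) :&: U)) :\: T.
pose Q := [set w |: T | w in W].
have cQ : #|Q| <= 2 * r * q ^ r.
  apply: leq_trans (leq_imset_card _ _) _; rewrite cardsD.
  apply: leq_trans (leq_subr _ _) _.
  apply: leq_trans (leq_card_setU _ _) _; rewrite hr //.
  have -> : 2 * r * q ^ r = r * q ^ r + q ^ r * r by lia.
  apply: leq_add; first by rewrite leq_pmulr // expn_gt0; lia.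
  apply: leq_trans (leq_card_bigcup _ _) _.
  rewrite (eq_bigr (fun=> r)) => [|a _]; last by rewrite hr.
  rewrite sum_nat_const leq_mul2r; apply/orP; right.
  apply: leq_trans (@leq_card_restr_pinned T (fun=> [set~ ord0]) F _ _) _.
  - move=> y j yF jT; move: (subsetP (hT y yF) j jT); rewrite !inE.
    by apply: contra => /eqP->.
  - by move=> j _; rewrite !inE eqxx.
  by rewrite prod_nat_const cardsC1 card_ord /= cT leq_exp2l // ltnW.
have b2 : #|F :\: F1| <= p * B.
  have sub : F :\: F1 \subset F := subsetDl _ _.
  apply: leq_trans (@leq_card_cover U r t.+1 Q _ _ _ _) _.
  - by move=> y /(subsetP sub)/hr.
  - move=> _ /imsetP[w wW ->]; move: wW; rewrite inE => /andP[wT wU].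
    rewrite cardsU1 wT cT; split=> //; rewrite subUset TU andbT sub1set.
    move: w wU {wT}; apply/subsetP; rewrite subUset subsetIr.
    by apply/bigcupsP => a _; exact: subsetIr.
  - move=> y; rewrite inE => /andP[nF1 yF].
    have [z [zF zW [j jT lt_s]]] : exists z, [/\ z \in F, (supp z :&: U) :\: T \subset W
           & exists2 j, j \in T & y j + z j < s].
      have [hy|] := boolP [forall j in T, c <= y j].
        exists x; split=> //; first by rewrite setSD // subsetUl.
        move: nF1; rewrite inE yF hy /= negbK => /eqP/ffunP/(_ i).
        rewrite !restr_in // => yi; exists i => //; rewrite yi cstE.
        by rewrite -cE ltn_add2l.
      (* The representative agrees with [y] on [T], so the sum at [j] is [2 * y j], which is below
         [s] because [y j < uphalf s]. *)
      rewrite negb_forall_in => /exists_inP[j jT]; rewrite -ltnNge => lt_c.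
      exists (g (restr T y)); split=> //.
        rewrite setSD // (subset_trans _ (subsetUr _ _)) //.
        by apply: (bigcup_max (restr T y)); rewrite ?imset_f.
      exists j => //; have /ffunP/(_ j) := gE y yF; rewrite !restr_in // => ->.
      by move: lt_c cE c_half; rewrite /c uphalf_half; lia.
    have [w] := region_meet_outside qs tr rF TU cT yF zF jT lt_s.
    rewrite inE -setIA in_setI => /and3P[wT wy wz].
    exists (w |: T); last by rewrite subUset sub1set wy hT.
    by apply: imset_f; apply: (subsetP zW); rewrite inE wT.
  rewrite mulnCA; apply: leq_mul; first by rewrite subset_leq_card // imsetS.
  apply: leq_trans (leq_pmull _ _); last by rewrite expn_gt0; lia.
  apply: leq_trans (ratio_bin tr Ur); rewrite mulnA leq_mul2r; apply/orP; right.
  apply: leq_trans (_ : 2 * r * q ^ r * q ^ r <= _); first by rewrite leq_mul2r cQ orbT.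
  rewrite -mulnA -expnD addnn -mul2n /ratio leq_mul2r; apply/orP; right.
  apply: leq_trans (_ : 2 ^ r.+1 <= _).
    by rewrite expnS leq_mul2l ltnW // ltn_expl.
  rewrite leq_exp2l // -addn1 leq_add2l muln_gt0 expn_gt0 /=; lia.
have Dpos : 0 < (q.+1 - c) ^ t by rewrite expn_gt0 subn_gt0 ltnS cq.
(* The one pattern missing from [F1] leaves room for exactly [p * B], which absorbs [F :\: F1]. *)
have -> : p * ((q.+1 - c) ^ t * B) = p * (((q.+1 - c) ^ t).-1 * B) + p * B.
  by rewrite -{1}(prednK Dpos) mulSn mulnDr addnC.
by rewrite -(cardsID F1 F) (setIidPr F1F) leq_add.
Qed.

Lemma stability s U r t F :
    1 < q -> q < s -> s <= 2 * q -> t < r -> threshold r <= #|U| ->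
    region_family s U r t F ->
  #|F| <= #|restr (~: U) @: F| *
          ((q.+1 - uphalf s) ^ t * (q ^ (r - t) * 'C(#|U| - t, r - t))) \/
  exists T, [/\ T \subset U, #|T| = t
              & forall x i, x \in F -> i \in T -> s./2 <= x i].
Proof.
move=> q2 qs s2q tr Ur rF; have [hr _] := rF.
have [/existsP[T /and3P[TU /eqP cT /forall_inP hT]]|noT] :=
  boolP [exists T : {set 'I_n}, [&& T \subset U, #|T| == t
           & [forall x in F, T \subset supp x]]].
  have [hi|] := boolP [forall x in F, [forall i in T, s./2 <= x i]].
    right; exists T; split=> // x i xF iT.
    by move/forall_inP/(_ x xF)/forall_inP: hi => ->.
  rewrite negb_forall_in => /exists_inP[x xF]; rewrite negb_forall_in.
  case/exists_inP=> i iT; rewrite -ltnNge => xi; left.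
  exact: deviating_bound xF iT xi.
left; have [|Q [cQ hQ hF]] := ex_kernel qs (ltnW tr) rF.
  move=> T TU cT; move: noT; rewrite negb_exists => /forallP/(_ T).
  by rewrite TU cT eqxx /= negb_forall_in => /exists_inP[x xF nT]; exists x.
apply: leq_trans (leq_card_cover hr hQ hF) _.
rewrite mulnCA leq_mul2l; apply/orP; right.
(* The number of patterns and the power of [q] in the main term are at least 1, so comparing the
   binomials suffices. *)
apply: leq_trans (leq_pmull _ _); last by rewrite expn_gt0; lia.
apply: leq_trans (leq_pmull _ _); last by rewrite expn_gt0; lia.
apply: leq_trans (ratio_bin tr Ur); rewrite mulnA leq_mul2r; apply/orP; right.
by rewrite /ratio leq_mul // leq_exp2l // mul2n -addnn leq_addr.
Qed.


(** * The odd case: main term and induction on the support size *)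

(* The term of index [j] counts the blocks of the odd family with [max1 T = j.+1]. *)
Definition odd_main h m r t :=
  \sum_(j < r) 'C(j, t.-1) * ((q - h) ^ t * (q ^ (r - j.+1) * 'C(m - j.+1, r - j.+1))).

(** The first summand is the term [j = t - 1] of [odd_main]. After exchanging sums, the coefficient
    for index [j + t] is the sum of ['C(t, z.+1) * 'C(j, z)], which [sum_bin_shift] bounds by
    ['C(j + t, t.-1)]. *)
Lemma odd_main_rec h m r t : 0 < t -> t <= r ->
  (q - h) ^ t * (q ^ (r - t) * 'C(m - t, r - t)) +
  \sum_(z < r - t) 'C(t, z.+1) * ((q - h) ^ (t - z.+1) * odd_main h (m - t) (r - t) z.+1)
  <= odd_main h m r t.
Proof.
move=> t0 tr.
have -> : odd_main h m r t = \sum_(0 <= j < r) 'C(j, t.-1) *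
    ((q - h) ^ t * (q ^ (r - j.+1) * 'C(m - j.+1, r - j.+1))) by rewrite big_mkord.
rewrite (big_cat_nat (n := t)) //=; apply: leq_add.
  case: t t0 tr => // t _ tr.
  by rewrite big_nat_recr //= binn mul1n leq_addl.
rewrite (_ : \sum_(t <= _ < r) _ = \sum_(0 <= j < r - t) 'C(j + t, t.-1) *
    ((q - h) ^ t * (q ^ (r - (j + t).+1) * 'C(m - (j + t).+1, r - (j + t).+1))));
  last by rewrite -[X in \sum_(X <= _ < _) _]add0n big_addn.
rewrite big_mkord.
pose D j := (q - h) ^ t * (q ^ (r - t - j.+1) * 'C(m - t - j.+1, r - t - j.+1)).
apply: leq_trans (_ : \sum_(z < r - t) \sum_(j < r - t)
                        'C(t, z.+1) * 'C(j, z) * D j <= _).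
  apply: leq_sum => z _; have [lt_z|zt] := ltnP t z.+1.
    by rewrite bin_small ?mul0n.
  rewrite mulnA big_distrr /=; apply: leq_sum => j _.
  have -> : D j = (q - h) ^ (t - z.+1) * ((q - h) ^ z.+1 *
      (q ^ (r - t - j.+1) * 'C(m - t - j.+1, r - t - j.+1))).
    by rewrite [RHS]mulnA -expnD subnK.
  by rewrite -!mulnA leq_mul2l mulnCA leqnn orbT.
rewrite exchange_big /=; apply: leq_sum => j _; rewrite -big_distrl /=.
have e : r - (j + t).+1 = r - t - j.+1 by lia.
have e' : m - (j + t).+1 = m - t - j.+1 by lia.
rewrite e e' leq_mul2r; apply/orP; right; rewrite addnC.
exact: sum_bin_shift.
Qed.

(** Coordinates where both entries are at most [h] do not intersect. Two distinct members low on the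
    same [r - t + 1] points of their supports would thus intersect in at most [t - 1] coordinates,
    so choosing such a set of low points for each member is injective. *)
Lemma leq_card_many_low h s U r t F T : q < s -> s = h.*2.+1 -> 0 < t <= r ->
    region_family s U r t F -> T \subset U -> #|T| = t ->
    (forall x, x \in F -> T \subset supp x) ->
  #|[set x in F | r - t < #|[set i in T | x i <= h]|]| <= 'C(t, (r - t).+1).
Proof.
move=> qs sE /andP[t0 tr] [hr hF] TU cT hT; set G := [set x in F | _].
pose L x := [set i in T | x i <= h].
pose g x : {set 'I_n} :=
  odflt set0 [pick S : {set 'I_n} | S \subset L x & #|S| == (r - t).+1].
have gP x : x \in G -> g x \subset L x /\ #|g x| = (r - t).+1.
  rewrite inE => /andP[_ /ex_subset_card[S SL cS]].
  rewrite /g; case: pickP => [S' /andP[? /eqP ?] //|/(_ S)].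
  by rewrite SL cS eqxx.
have inj : {in G &, injective g}.
  move=> x y xG yG e; apply/eqP; apply/negP => /negP/eqP nxy.
  have [xF yF] : x \in F /\ y \in F.
    by move: xG yG; rewrite !inE => /andP[-> _] /andP[-> _].
  have := hF x y xF yF nxy; apply/negP; rewrite -ltnNge.
  have [gx cx] := gP x xG; have [gy _] := gP y yG.
  have sub : [set i in U | s <= x i + y i] \subset (supp x :&: U) :\: g x.
    apply/subsetP => i; rewrite !inE => /andP[iU le_s].
    have := sum_supp qs le_s; rewrite !inE => /andP[-> _]; rewrite iU !andbT.
    apply/negP => ig; move: (subsetP gx i ig); rewrite e in ig.
    move: (subsetP gy i ig); rewrite !inE => /andP[_ h1] /andP[_ h2].
    by have := leq_trans le_s (leq_add h2 h1); rewrite sE addnn ltnn.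
  apply: leq_ltn_trans (subset_leq_card sub) _.
  rewrite cardsD hr // (setIidPr _) ?cx; first by lia.
  apply: subset_trans gx _; rewrite subsetI; apply/andP; split.
    apply: subset_trans (hT x xF).
    by apply/subsetP => i; rewrite !inE => /andP[].
  apply: subset_trans TU.
    by apply/subsetP => i; rewrite !inE => /andP[].
rewrite -(card_in_imset inj) -cT -cards_draws; apply: subset_leq_card.
apply/subsetP => _ /imsetP[x /gP[gx cx] ->]; rewrite inE cx cT eqxx andbT.
apply: subset_trans gx _; by apply/subsetP => i; rewrite inE => /andP[].
Qed.


Lemma threshold_sub r t : 0 < q -> t <= r -> threshold (r - t) <= threshold r - t.
Proof.
move=> q0 tr; have rt : r - t <= r := leq_subr _ _.
rewrite /threshold -addnBAC // leq_add2l leq_mul // /ratio.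
apply: leq_mul; apply: leq_pexp2l => //; last by rewrite leq_mul2l rt orbT.
by rewrite leq_add // leq_mul // leq_pexp2l.
Qed.

(** This is the inductive step, with the induction hypothesis as a premise. The bound [h <= x i]
    comes from [stability], hence only for [t < r]; it serves the classes with [0 < #|S| <= r - t],
    which exist only then. *)
Lemma odd_step s h U r t F T :
    1 < q -> q < s -> s <= 2 * q -> s = h.*2.+1 -> 0 < t <= r ->
    region_family s U r t F -> T \subset U -> #|T| = t ->
    (forall x, x \in F -> T \subset supp x) ->
    (t < r -> forall x i, x \in F -> i \in T -> h <= x i) ->
    (forall z (G : {set qvec q n}), 0 < z <= r - t ->
       region_family s (U :\: T) (r - t) z G ->
       #|G| <= #|restr (~: (U :\: T)) @: G| * odd_main h #|U :\: T| (r - t) z +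
               'C(r - t, z.-1)) ->
  #|F| <= #|restr (~: U) @: F| * odd_main h #|U| r t + 'C(r, t.-1).
Proof.
move=> q2 qs s2q sE trt rF TU cT hT hh IH; have /andP[t0 tr] := trt; have [hr hF] := rF.
have hq : h <= q by lia.
set p := #|restr (~: U) @: F|.
pose L x := [set i in T | x i <= h].
pose FL S := [set x in F | L x == S].
have LT x : L x \subset T by apply/subsetP => i; rewrite inE => /andP[].
have cUT : #|U :\: T| = #|U| - t by rewrite cardsD (setIidPr TU) cT.
have FLF S : FL S \subset F by apply/subsetP => x; rewrite inE => /andP[].
have pFL S : #|restr (~: U) @: FL S| <= p by rewrite subset_leq_card // imsetS.
have bL S : S \in powerset T -> 0 < #|S| <= r - t ->
    #|FL S| <= p * ((q - h) ^ (t - #|S|) * odd_main h (#|U| - t) (r - t) #|S|) +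
               'C(r - t, #|S|.-1).
  rewrite inE => ST S0; have lt_tr : t < r by lia.
  have xS x i : x \in FL S -> i \in T -> if i \in S then x i = h :> nat else h < x i.
    move=> xFL iT; move: (xFL); rewrite inE => /andP[xF /eqP <-].
    rewrite inE iT /=; have := hh lt_tr x i xF iT.
    by case: (ltngtP (x i) h).
  have rFL : region_family s (U :\: T) (r - t) #|S| (FL S).
    split=> [x xFL|x y xFL yFL nxy].
      have xF := subsetP (FLF S) x xFL.
      by rewrite setIDA cardsD hr // -setIA (setIidPr TU) (setIidPr _) ?hT // cT.
    have [xF yF] := (subsetP (FLF S) x xFL, subsetP (FLF S) y yFL).
    have := hF x y xF yF nxy; set I := [set i in U | _] => tI.
    have IT : I :&: T \subset T :\: S.
      apply/subsetP => i; rewrite !inE => /andP[/andP[_ le_s] iT].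
      rewrite iT andbT; apply/negP => iS.
      by move: (xS x i xFL iT) (xS y i yFL iT) le_s; rewrite iS sE => -> ->; lia.
    have := subset_leq_card IT; rewrite cardsD (setIidPr ST) cT => cIT.
    have -> : [set i in U :\: T | s <= x i + y i] = I :\: T.
      by apply/setP => i; rewrite !inE andbA.
    have := subset_leq_card ST; have := cardsID T I; rewrite cT; lia.
  apply: leq_trans (IH _ _ S0 rFL) _; rewrite leq_add2r cUT mulnA leq_mul2r.
  (* The complement of the new region gains [T], on which a member of [FL S] equals [h] on [S] and
     takes one of [q - h] values at each other point. *)
  apply/orP; right; rewrite setCD; apply: leq_trans (leq_card_restrU _ _ _) _.
  apply: leq_mul => //.
  pose A i : {set 'I_q.+1} :=
    if i \in S then [set inord h] else [set a : 'I_q.+1 | h < a].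
  apply: leq_trans (@leq_card_restr_pinned T A _ _ _) _.
  - move=> x i xFL iT; have := xS x i xFL iT; rewrite /A; case: ifP => _.
      by move=> xi; rewrite inE; apply/eqP/val_inj; rewrite /= inordK.
    by rewrite inE.
  - move=> i _; rewrite /A; case: ifP => _; rewrite inE //.
    by apply/eqP => /(congr1 val); rewrite /= inordK // ; lia.
  rewrite (bigID (mem S)) /= big1 ?mul1n.
    rewrite (eq_bigr (fun=> q - h)); last first.
      by move=> i /andP[_ /negbTE iS]; rewrite /A iS card_ord_geq subSS.
    rewrite prod_nat_const (_ : #|_| = t - #|S|) //.
    rewrite -cT -(_ : #|T :\: S| = #|T| - #|S|); last by rewrite cardsD (setIidPr ST).
    by apply: eq_card => i; rewrite !inE andbC.
  by move=> i /andP[_ iS]; rewrite /A iS cards1.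
have b0 : #|FL set0| <= p * ((q - h) ^ t * (q ^ (r - t) * 'C(#|U| - t, r - t))).
  have := @leq_card_pinned U T r (fun=> [set a : 'I_q.+1 | h < a]) (FL set0) TU.
  rewrite prod_nat_const card_ord_geq subSS cT => bnd.
  apply: leq_trans (bnd _ _ _) _.
  - by move=> x /(subsetP (FLF _))/hr.
  - move=> x i; rewrite !inE => /andP[_ /eqP/setP/(_ i)]; rewrite !inE => + iT.
    by rewrite iT ltnNge => /negbT.
  - by move=> i _; rewrite inE.
  by rewrite leq_mul2r pFL orbT.
have bbig := leq_card_many_low qs sE trt rF TU cT hT.
set Fbig := [set x in F | _] in bbig.
have cover : F \subset FL set0 :|: (Fbig :|:
    \bigcup_(S in [set S in powerset T | 0 < #|S| <= r - t]) FL S).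
  apply/subsetP => x xF; rewrite !in_setU.
  have [l0|l0] := posnP #|L x|.
    by rewrite inE xF -cards_eq0 l0.
  have [ls|lb] := leqP #|L x| (r - t); last first.
    by rewrite [in X in _ || (X || _)]inE xF lb orbT.
  apply/orP; right; apply/orP; right; apply/bigcupP; exists (L x).
    by rewrite !inE LT l0 ls.
  by rewrite inE xF eqxx.
apply: leq_trans (subset_leq_card cover) _.
apply: leq_trans (leq_card_setU _ _) _.
apply: leq_trans (leq_add b0 (leq_card_setU _ _)) _.
apply: leq_trans (leq_add (leqnn _) (leq_add bbig (leq_card_bigcup _ _))) _.
rewrite (eq_bigl (fun S => (S \in powerset T) && (0 < #|S| <= r - t))); last first.
  by move=> S; rewrite inE.
have bsum : \sum_(S in powerset T | 0 < #|S| <= r - t) #|FL S| <=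
    \sum_(z < r - t) 'C(t, z.+1) *
      (p * ((q - h) ^ (t - z.+1) * odd_main h (#|U| - t) (r - t) z.+1) + 'C(r - t, z)).
  have := sum_subsets_card T (r - t) (fun z =>
    p * ((q - h) ^ (t - z) * odd_main h (#|U| - t) (r - t) z) + 'C(r - t, z.-1)).
  by rewrite cT /= => <-; apply: leq_sum => S /andP[ST S0]; exact: bL.
apply: leq_trans (leq_add (leqnn _) (leq_add (leqnn _) bsum)) _.
under eq_bigr do rewrite mulnDr mulnCA.
rewrite big_split /= -big_distrr /=.
rewrite [X in _ + X]addnCA [X in X <= _]addnA -mulnDr; apply: leq_add.
  by rewrite leq_mul2l odd_main_rec ?orbT.
(* The bound for the members with many low entries is the missing term [z = r - t] of the
   Vandermonde sum of the error terms. *)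
rewrite addnC; have := @sum_bin_shift t (r - t) (r - t).+1 t0.
by rewrite big_ord_recr /= binn muln1 subnKC.
Qed.

Lemma odd_bound s U r t F :
    1 < q -> q < s -> s <= 2 * q -> odd s -> 0 < t <= r -> threshold r <= #|U| ->
    region_family s U r t F ->
  #|F| <= #|restr (~: U) @: F| * odd_main s./2 #|U| r t + 'C(r, t.-1).
Proof.
move=> q2 qs s2q os.
have sE : s = s./2.*2.+1 by rewrite -[LHS]odd_double_half os.
elim/ltn_ind: r U t F => r IH U t F trt Ur rF; have /andP[t0 tr] := trt.
have [hr hF] := rF.
have [->|[x0 x0F]] := set_0Vmem F; first by rewrite cards0.
have [bnd|[T [TU cT hT hh]]] : #|F| <= #|restr (~: U) @: F| * odd_main s./2 #|U| r t \/
    exists T, [/\ T \subset U, #|T| = t, forall x, x \in F -> T \subset supp x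
      & t < r -> forall x i, x \in F -> i \in T -> s./2 <= x i].
- move: tr; rewrite leq_eqVlt => /orP[/eqP e|tr].
    (* For [t = r] any two supports meet [U] in the same [r] points, which serve as [T]. *)
    right; exists (supp x0 :&: U).
    split; rewrite ?e ?ltnn ?subsetIr ?hr // => x xF.
    have := region_meet qs _ rF x0F xF; rewrite e => /(_ (leqnn _)) m.
    have /eqP <- : supp x0 :&: supp x :&: U == supp x0 :&: U.
      by rewrite eqEcard hr // m andbT setSI // subsetIl.
    by rewrite -setIA setICA subsetIl.
  have [bnd|[T [TU cT hT]]] := stability q2 qs s2q tr Ur rF.
    left; apply: leq_trans bnd _; rewrite leq_mul2l; apply/orP; right.
    (* For odd [s] the stability bound is the first summand of [odd_main_rec]. *)
    apply: leq_trans (odd_main_rec _ _ t0 (ltnW tr)); rewrite uphalf_half os subSS.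
    exact: leq_addr.
  right; exists T; split=> // x xF; apply/subsetP => i iT; rewrite inE.
  by have := hT x i xF iT; rewrite /= ; lia.
- exact: leq_trans bnd (leq_addr _ _).
apply: (odd_step q2 qs s2q sE trt rF TU cT hT hh) => z G zr rG.
apply: IH => //; first by lia.
rewrite cardsD (setIidPr TU) cT.
by apply: leq_trans (threshold_sub _ tr) (leq_sub2r _ Ur); exact: ltnW.
Qed.


(** * The full coordinate set and the even case *)

Lemma card_restr_setT F x : x \in F -> #|restr (~: setT) @: F| = 1.
Proof.
move=> xF; apply/eqP/cards1P; exists (restr set0 x); apply/setP => y.
have e z z' : restr set0 z = restr set0 z' by apply/ffunP => i; rewrite !ffunE inE.
rewrite setCT inE; apply/imsetP/eqP => [[z _ ->]|->]; first exact: e.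
by exists x.
Qed.

Lemma region_setT s r t F : support_uniform r F -> sum_intersecting s t F ->
  region_family s setT r t F.
Proof.
move=> hr hF; split=> [x xF|x y xF yF nxy]; first by rewrite setIT hr.
have := hF x y xF yF nxy; rewrite /sum_intersect => /leq_trans; apply.
by apply: subset_leq_card; apply/subsetP => i; rewrite !inE.
Qed.

(** For [t < r] both outcomes of [stability] give the bound, as [uphalf s = s./2]. For [t = r] all
    supports coincide and an injection into the extremal family on that support is used. *)
Lemma even_bound s r t F : 1 < q -> q < s -> s <= 2 * q -> ~~ odd s ->
    0 < t <= r -> threshold r <= n -> region_family s setT r t F ->
  #|F| <= (q.+1 - s./2) ^ t * (q ^ (r - t) * 'C(n - t, r - t)).
Proof.
move=> q2 qs s2q os /andP[t0 tr] rn rF; have [hr hF] := rF.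
have [->|[x0 x0F]] := set_0Vmem F; first by rewrite cards0.
have sE : s = s./2.*2 by rewrite -[LHS]odd_double_half (negbTE os).
set h := s./2 in sE *; have h0 : 0 < h by lia.
have hq : h <= q by lia.
pose A (_ : 'I_n) := [set a : 'I_q.+1 | h <= a].
have A0 T i : i \in T -> ord0 \notin A i by rewrite inE -ltnNge.
have prodA T : \prod_(i in T) #|A i| = (q.+1 - h) ^ #|T|.
  by rewrite -prod_nat_const; apply: eq_bigr => i _; rewrite card_ord_geq.
move: tr; rewrite leq_eqVlt => /orP[/eqP tr|tr]; last first.
  have nT : n = #|[set: 'I_n]| by rewrite cardsT card_ord.
  rewrite {1}nT in rn.
  have [|[T [TU cT hT]]] := stability q2 qs s2q tr rn rF.
    by rewrite (card_restr_setT x0F) mul1n -nT uphalf_half (negbTE os).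
  have := @leq_card_pinned setT T r A F TU hr.
  rewrite prodA (card_restr_setT x0F) mul1n -nT cT; apply; last exact: A0.
  by move=> x i xF iT; rewrite inE hT.
rewrite -tr subnn bin0 !muln1; pose T := supp x0.
have cT : #|T| = t by rewrite -[T]setIT hr.
have hT x : x \in F -> supp x = T.
  move=> xF; have := region_meet qs _ rF x0F xF; rewrite tr => /(_ (leqnn _)).
  rewrite setIT => m; have sx : supp x0 :&: supp x = T.
    by apply/eqP; rewrite eqEcard subsetIl cT tr.
  apply/eqP; rewrite eq_sym eqEcard -{1}sx subsetIr cT.
  by rewrite /= -[supp x]setIT hr // tr.
(* [phi] raises entries of [T] below [h] to [h]. Distinct members satisfy [x i + y i >= 2 * h] on
   all of [T], so two entries that are both at most [h] must both equal [h]; hence no information is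
   lost. *)
pose phi x : qvec q n := restr T [ffun i => if x i <= h then inord h else x i].
have inj : {in F &, injective phi}.
  move=> x y xF yF /ffunP e; case: (x =P y) => // nxy.
  have le_t := hF x y xF yF nxy.
  have sub : [set i in setT | s <= x i + y i] \subset T.
    by apply/subsetP => i; rewrite inE => /andP[_ /(sum_supp qs)];
      rewrite in_setI hT // => /andP[].
  have /eqP eT : [set i in setT | s <= x i + y i] == T by rewrite eqEcard sub cT.
  apply/ffunP => i; have [iT|iT] := boolP (i \in T); last first.
    have : i \notin supp x by rewrite hT.
    have : i \notin supp y by rewrite hT.
    by rewrite !inE !negbK => /eqP yi /eqP xi; apply: val_inj; rewrite xi yi.
  move: (e i); rewrite /phi !restr_in // !ffunE.
  move: (iT); rewrite -eT inE /= {1}sE => /andP[_ le_s].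
  case: (leqP (x i) h) => xi; case: (leqP (y i) h) => yi // ei.
  - have eq_h a b : h.*2 <= a + b -> a <= h -> b <= h -> a = b by lia.
    exact/ord_inj/(eq_h _ _ le_s).
  - by move: yi; rewrite -ei inordK // ltnn.
  - by move: xi; rewrite ei inordK // ltnn.
rewrite -(card_in_imset inj) -cT -(prodA T) -(card_pinned_self (A0 T)).
apply: subset_leq_card; apply/subsetP => _ /imsetP[x xF ->].
apply: restr_pinned (A0 T) _ => i iT; rewrite inE ffunE.
by case: (leqP (x i) h) => [_|/ltnW //]; rewrite inordK.
Qed.

(** * Extremal families: sizes and intersection properties *)

Lemma card_seg m : m <= n -> #|seg n m| = m.
Proof.
move=> mn; rewrite -sum1dep_card -(big_ord_widen _ (fun=> 1) mn).
by rewrite sum_nat_const card_ord muln1.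
Qed.

Lemma leq_seg j m : j <= m -> seg n j \subset seg n m.
Proof. by move=> jm; apply/subsetP => i; rewrite !inE => /leq_trans; apply. Qed.

Lemma sub_seg_max1 T : T \subset seg n (max1 T).
Proof. by apply/subsetP => i iT; rewrite inE /max1 (bigD1 i) //= leq_maxl. Qed.

Lemma max1_leq T m : T \subset seg n m -> max1 T <= m.
Proof. by move=> /subsetP sT; apply/bigmax_leqP => i /sT; rewrite inE. Qed.

Lemma odd_block_ge s r T y i : y \in odd_block q s r T ->
  i \in seg n (max1 T) -> s./2 <= y i.
Proof.
rewrite inE => /and3P[/forall_inP h1 /forall_inP h2 _] im.
have [iT|iT] := boolP (i \in T); first exact/ltnW/h1.
by have /eqP <- : val (y i) == s./2 by apply: h2; rewrite inE iT.
Qed.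

(** Let [T1] have the smaller maximum. A point of [T1] outside [T2] would lie below the maximum of
    [T2], so [y] would equal [s./2] there by one block and exceed it by the other. *)
Lemma odd_block_inj s r T1 T2 y : #|T1| = #|T2| ->
  y \in odd_block q s r T1 -> y \in odd_block q s r T2 -> T1 = T2.
Proof.
wlog le_m : T1 T2 / max1 T1 <= max1 T2.
  by move=> H c y1 y2; case: (leqP (max1 T1) (max1 T2)) => [|/ltnW] m;
     [|apply/esym]; exact: H.
move=> c; rewrite !inE => /and3P[/forall_inP h1 _ _] /and3P[_ /forall_inP h2 _].
apply/eqP; rewrite eqEcard c leqnn andbT; apply/subsetP => i iT1.
apply/negPn/negP => iT2.
have : val (y i) == s./2.
  by apply: h2; rewrite inE iT2 (subsetP (leq_seg le_m)) // (subsetP (sub_seg_max1 T1)).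
by move/eqP => e; have := h1 i iT1; rewrite /= -e ltnn.
Qed.

Lemma card_odd_block s r t T : q < s -> s <= 2 * q -> 1 < q -> r <= n ->
    T \in subsets n r t ->
  #|odd_block q s r T| = (q - s./2) ^ t *
     (q ^ (r - max1 T) * 'C(n - max1 T, r - max1 T)).
Proof.
move=> qs s2q q2 rn; rewrite inE => /andP[Tr /eqP cT].
have mr := max1_leq Tr; have mn := leq_trans mr rn.
pose A i : {set 'I_q.+1} :=
  if i \in T then [set a : 'I_q.+1 | s./2 < a] else [set inord s./2].
have hq : s./2 <= q by lia.
have TS := sub_seg_max1 T.
have -> : odd_block q s r T = pinned setT r (seg n (max1 T)) A.
  apply/setP => y; rewrite !inE subsetT /= andbA andbC; congr (_ && _).
  apply/andP/forall_inP => [[/forall_inP h1 /forall_inP h2] i im|hy].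
    rewrite /A; case: ifP => iT; first by rewrite inE h1.
    rewrite inE; apply/eqP/val_inj; rewrite /= inordK //.
    by apply/eqP; apply: h2; rewrite inE iT.
  split; apply/forall_inP => i.
    by move=> iT; have := hy i (subsetP TS i iT); rewrite /A iT inE.
  rewrite inE => /andP[/negbTE iT im]; have := hy i im; rewrite /A iT inE => /eqP->.
  by rewrite /= inordK.
rewrite card_pinned ?subsetT ?card_seg ?cardsT ?card_ord //; last first.
  move=> i _; rewrite /A; case: ifP => _; rewrite inE //.
  by apply/eqP => /(congr1 val); rewrite /= inordK //; lia.
congr (_ * _); rewrite (bigID (mem T)) /= [X in _ * X]big1 ?muln1.
  rewrite (eq_bigr (fun=> q - s./2)); last first.
    by move=> i /andP[_ iT]; rewrite /A iT card_ord_geq subSS.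
  rewrite prod_nat_const -cT -[in RHS](setIidPr TS); congr (_ ^ _).
  by apply: eq_card => i; rewrite in_setI.
by move=> i /andP[_ /negbTE iT]; rewrite /A iT cards1.
Qed.

Lemma max1_setU1 (j : 'I_n) S : S \subset seg n j -> max1 (j |: S) = j.+1.
Proof.
move=> Sj; apply/eqP; rewrite eqn_leq; apply/andP; split.
  apply: max1_leq; rewrite subUset sub1set inE ltnSn /=.
  exact: subset_trans Sj (leq_seg (leqnSn _)).
by have := subsetP (sub_seg_max1 (j |: S)) j (setU11 _ _); rewrite inE.
Qed.

(** The [t]-sets with 0-based maximum [j] include those obtained by adding [j] to a [(t - 1)]-subset
    of [seg n j], which gives ['C(j, t.-1)] of them. *)
Lemma leq_sum_max1 r t (G : nat -> nat) : 0 < t -> r <= n ->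
  \sum_(j < r) 'C(j, t.-1) * G j.+1 <= \sum_(T in subsets n r t) G (max1 T).
Proof.
move=> t0 rn.
have mr T : T \in subsets n r t -> 0 < max1 T <= r.
  rewrite inE => /andP[Tr /eqP cT]; rewrite (max1_leq Tr) andbT.
  have : 0 < #|T| by rewrite cT.
  case/card_gt0P => i iT; have := subsetP (sub_seg_max1 T) i iT.
  by rewrite inE; apply: leq_ltn_trans.
case: r rn mr => [|r] rn mr; first by rewrite big_ord0.
rewrite [leqRHS](partition_big (fun T => inord (max1 T).-1 : 'I_r.+1) xpredT) //=.
apply: leq_sum => j _; pose j' := widen_ord rn j.
have inj : {in subsets n j t.-1 &, injective (fun S => j' |: S)}.
  move=> S1 S2; rewrite !inE => /andP[S1j _] /andP[S2j _] e.
  have nin S : S \subset seg n j -> j' \notin S.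
    by move=> Sj; apply/negP => /(subsetP Sj); rewrite inE /= ltnn.
  by rewrite -(setU1K (nin S1 S1j)) e setU1K // nin.
rewrite (_ : 'C(j, t.-1) = #|(fun S => j' |: S) @: subsets n j t.-1|); last first.
  rewrite (card_in_imset inj) /subsets cards_draws card_seg //.
  exact: leq_trans (ltnW (ltn_ord j)) rn.
rewrite -sum_nat_const.
have sub S : S \in (fun S => j' |: S) @: subsets n j t.-1 ->
    (S \in subsets n r.+1 t) && (inord (max1 S).-1 == j) /\ max1 S = j.+1.
  case/imsetP => S1; rewrite inE => /andP[S1j /eqP c1] ->.
  rewrite (max1_setU1 (j := j')) //; split=> //; rewrite /= inord_val eqxx andbT inE.
  rewrite subUset sub1set inE /= ltn_ord /= (subset_trans S1j) ?leq_seg 1?ltnW //=.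
  rewrite cardsU1 c1 (_ : j' \notin S1) ?add1n ?prednK //.
  by apply/negP => /(subsetP S1j); rewrite inE /= ltnn.
rewrite [leqRHS](bigID (mem ((fun S => j' |: S) @: subsets n j t.-1))) /=.
apply: leq_trans (leq_addr _ _).
rewrite [leqRHS](eq_bigl (mem ((fun S => j' |: S) @: subsets n j t.-1))); last first.
  by move=> S /=; apply/andb_idl => /sub[].
by apply: leq_sum => S /sub[_ ->].
Qed.


Lemma admissible_ge s r t (c : {set 'I_n} -> qvec q n) T i :
  admissible s r t c -> T \in subsets n r (t - 1) -> i \in seg n r -> s./2 <= c T i.
Proof.
move=> ac TP ir; have [_ h1 h2] := ac T TP.
have [iT|iT] := boolP (i \in T); last by rewrite h2 // inE iT.
by have := h1 i iT; lia.
Qed.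

(** On [seg n r] a chosen vector exceeds [s / 2] exactly on its index set, so [c] is injective. That
    set has [t - 1] points, whereas block members exceed [s / 2] on at least [t] points of
    [seg n r], so the two parts are disjoint. *)
Lemma leq_odd_family s r t (c : {set 'I_n} -> qvec q n) :
    1 < q -> q < s -> s <= 2 * q -> 0 < t -> r <= n -> admissible s r t c ->
  odd_main s./2 n r t + 'C(r, t.-1) <= #|odd_family s r t c|.
Proof.
move=> q2 qs s2q t0 rn ac.
have rec T : T \in subsets n r (t - 1) -> [set i in seg n r | s < 2 * c T i] = T.
  move=> TP; have [_ h1 h2] := ac T TP.
  move: TP; rewrite inE => /andP[/subsetP sT _].
  apply/setP => i; rewrite inE; case iT: (i \in T).
    by rewrite sT //= h1.
  case ir: (i \in seg n r) => //=; rewrite h2; last by rewrite inE iT ir.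
  by lia.
have inj : {in subsets n r (t - 1) &, injective c}.
  by move=> T T' TP TP' e; rewrite -(rec T TP) -(rec T' TP') e.
rewrite /odd_family cardsU (card_in_imset inj) (_ : _ :&: _ = set0); last first.
  apply/setP => y; rewrite !inE; apply/negbTE/negP => /andP[/imsetP[T TP ->]].
  case/bigcupP => U; rewrite inE => /andP[/subsetP sU /eqP cU].
  rewrite inE => /and3P[/forall_inP hU _ _].
  have : #|U| <= #|T|.
    rewrite -(rec T TP); apply/subset_leq_card/subsetP => i iU.
    by rewrite inE sU //=; have := hU i iU; lia.
  by move: TP; rewrite inE cU => /andP[_ /eqP->]; lia.
rewrite cards0 subn0 addnC; apply: leq_add.
  by rewrite /subsets cards_draws card_seg // subn1.
apply: leq_trans (leq_sum_card_bigcup _); last first.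
  move=> T1 T2 y TP1 TP2; apply: odd_block_inj.
  by move: TP1 TP2; rewrite !inE => /andP[_ /eqP->] /andP[_ /eqP->].
rewrite (eq_bigr _ (fun T => card_odd_block qs s2q q2 rn)).
exact: (@leq_sum_max1 r t (fun j => (q - s./2) ^ t * (q ^ (r - j) * 'C(n - j, r - j)))).
Qed.

Lemma odd_family_uniform s r t (c : {set 'I_n} -> qvec q n) : r <= n ->
  admissible s r t c -> support_uniform r (odd_family s r t c).
Proof.
move=> rn ac x /setUP[/imsetP[T TP ->]|/bigcupP[T _]].
  by have [-> _ _] := ac T TP; rewrite card_seg.
by rewrite inE => /and3P[_ _ /eqP].
Qed.

(** A sum reaches [s] once one entry exceeds [s./2] and the other is at least [s./2]. Of two block
    members, the one whose block has the smaller maximum supplies the [t] large entries; a block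
    member also does so against a chosen vector. *)
Lemma odd_family_intersecting s r t (c : {set 'I_n} -> qvec q n) :
    odd s -> 0 < t -> admissible s r t c ->
  sum_intersecting s t (odd_family s r t c).
Proof.
move=> os t0 ac; have sE : s = s./2.*2.+1 by rewrite -[LHS]odd_double_half os.
have large T x y : #|T| = t -> (forall i, i \in T -> s./2 < x i) ->
    (forall i, i \in T -> s./2 <= y i) -> sum_intersect s t x y.
  move=> cT hx hy; rewrite /sum_intersect -{1}cT; apply: subset_leq_card.
  apply/subsetP => i iT; rewrite inE {1}sE -addnn -addSn.
  by apply: leq_add; [exact: hx | exact: hy].
have sym x y : sum_intersect s t x y -> sum_intersect s t y x.
  rewrite /sum_intersect => /leq_trans; apply; apply: subset_leq_card.
  by apply/subsetP => i; rewrite !inE addnC.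
have blk T x : T \in subsets n r t -> x \in odd_block q s r T ->
    [/\ #|T| = t, T \subset seg n r & forall i, i \in T -> s./2 < x i].
  by rewrite !inE => /andP[-> /eqP->] /and3P[/forall_inP ? _ _].
have cross T T' x : T \in subsets n r (t - 1) -> T' \in subsets n r t ->
    x \in odd_block q s r T' -> sum_intersect s t x (c T).
  move=> TP TP' /(blk _ _ TP')[cT' T'r hx]; apply: large cT' hx _ => i iT'.
  exact: admissible_ge ac TP (subsetP T'r i iT').
move=> x y /setUP[/imsetP[T TP ->]|/bigcupP[T TP xT]].
  case/setUP=> [/imsetP[T' TP' ->] ne|/bigcupP[T' TP' yT'] _]; last first.
    exact/sym/(cross T T').
  have nTT : T != T' by apply: contra_notN ne => /eqP->.
  have [_ h1 h2] := ac T TP; have [_ h1' h2'] := ac T' TP'.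
  move: (TP) (TP'); rewrite !inE => /andP[Tr /eqP cT] /andP[T'r /eqP cT'].
  (* For two chosen vectors the union of their distinct [(t - 1)]-sets has at least [t] points, and
     at each of them one of the two vectors is large. *)
  have cU : t <= #|T :|: T'|.
    rewrite (_ : t = (t - 1).+1); last by lia.
    rewrite -cT ltn_neqAle subset_leq_card ?subsetUl // andbT.
    apply: contra nTT => /eqP e; rewrite eq_sym eqEcard cT cT' leqnn andbT.
    have /eqP -> : T == T :|: T' by rewrite eqEcard subsetUl -e /=.
    exact: subsetUr.
  apply: leq_trans cU (subset_leq_card _); apply/subsetP => i.
  rewrite !inE => /orP[iT|iT'].
    have := h1 i iT; have := admissible_ge ac TP' (subsetP Tr i iT).
    by move: (c T i : nat) (c T' i : nat) => a b; lia.
  have := h1' i iT'; have := admissible_ge ac TP (subsetP T'r i iT').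
  by move: (c T i : nat) (c T' i : nat) => a b; lia.
case/setUP=> [/imsetP[T' TP' ->] _|/bigcupP[T' TP' yT'] _].
  exact: (cross T' T).
have wl T1 T2 x1 x2 : T1 \in subsets n r t ->
    x1 \in odd_block q s r T1 -> x2 \in odd_block q s r T2 ->
    max1 T1 <= max1 T2 -> sum_intersect s t x1 x2.
  move=> TP1 xT1 xT2 m; have [cT1 _ hx] := blk _ _ TP1 xT1.
  apply: large cT1 hx _ => i iT1; apply: (odd_block_ge xT2).
  by rewrite (subsetP (leq_seg m)) // (subsetP (sub_seg_max1 T1)).
by case: (leqP (max1 T) (max1 T')) => [|/ltnW] m; [|apply: sym]; apply: wl m.
Qed.

Lemma card_even_family s r t T : q < s -> s <= 2 * q -> 1 < q -> t <= r ->
    #|T| = t ->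
  #|even_family q s r T| = (q.+1 - s./2) ^ t * (q ^ (r - t) * 'C(n - t, r - t)).
Proof.
move=> qs s2q q2 tr cT.
have -> : even_family q s r T = pinned setT r T (fun=> [set a : 'I_q.+1 | s./2 <= a]).
  apply/setP => x; rewrite !inE subsetT /= andbC; congr (_ && _).
  by apply: eq_forallb_in => i _; rewrite inE.
rewrite card_pinned ?subsetT ?cT //; last first.
  by move=> i _; rewrite inE -ltnNge half_gt0; lia.
by rewrite prod_nat_const card_ord_geq cT cardsT card_ord.
Qed.

Lemma even_family_intersecting s r t T : q < s -> ~~ odd s -> #|T| = t ->
  sum_intersecting s t (even_family q s r T).
Proof.
move=> qs os cT x y; rewrite !inE => /andP[/forall_inP hx _] /andP[/forall_inP hy _] _.
rewrite /sum_intersect -{1}cT; apply: subset_leq_card; apply/subsetP => i iT.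
rewrite inE -[s in s <= _]odd_double_half (negbTE os) add0n -addnn.
by apply: leq_add; [exact: hx | exact: hy].
Qed.

End Vectors.

(** * Upper bounds and extremal families for large [n] *)

Theorem theorem2p11 (q s r t : nat)
    (hq : 2 <= q) (hqs : q < s) (hs : s <= 2 * q) (hr : t <= r) (ht : 1 <= t) :
  exists n0 : nat, forall n : nat, n0 <= n ->
    [/\ forall F : {set qvec q n},
          support_uniform r F -> sum_intersecting s t F ->
          #|F| <= (if odd s then f n q s r t
                   else (q - s./2 + 1) ^ t * q ^ (r - t) * 'C(n - t, r - t)),
        ~~ odd s -> forall T : {set 'I_n}, #|T| = t ->
          [/\ support_uniform r (@even_family q n s r T),
              sum_intersecting s t (@even_family q n s r T)
            & #|@even_family q n s r T| =
                (q - s./2 + 1) ^ t * q ^ (r - t) * 'C(n - t, r - t)]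
      & odd s -> forall c : {set 'I_n} -> qvec q n, admissible s r t c ->
          [/\ support_uniform r (odd_family s r t c),
              sum_intersecting s t (odd_family s r t c)
            & #|odd_family s r t c| = f n q s r t]].
Proof.
exists (threshold q r) => n rn.
have r_le_n : r <= n := leq_trans (leq_addr _ _) rn.
have qE : q - s./2 + 1 = q.+1 - s./2 by lia.
have trt : 0 < t <= r by rewrite ht.
split=> [F uF iF|os T cT|os c ac]; last split.
- have rF := region_setT uF iF.
  case: ifPn => os; last by rewrite qE -mulnA even_bound.
  have [->|[x0 x0F]] := set_0Vmem F; first by rewrite cards0.
  (* [f] is itself the size of an odd family, so the lower bound on that size is all that has to be
     matched. *)
  apply: leq_trans (leq_odd_family hq hqs hs ht r_le_n _); last first.
    exact: std_choice_admissible.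
  have := odd_bound hq hqs hs os trt _ rF.
  by rewrite (card_restr_setT x0F) cardsT card_ord mul1n; apply.
- split; [|exact: even_family_intersecting|].
    by move=> x; rewrite inE => /andP[_ /eqP].
  by rewrite (card_even_family (t := t)) // qE mulnA.
- exact: odd_family_uniform.
- exact: odd_family_intersecting.
- by apply: card_odd_family_indep => //; exact: std_choice_admissible.
Qed.
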